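(* Let $H$ be a real Hilbert space, let $K_1,\ldots,K_N$ be closed convex subsets of $H$ with $\bigcap_{i=1}^N K_i\neq\emptyset$, and let $f_1,\ldots,f_N:H\times H\to\mathbb{R}$ be bifunctions each satisfying conditions (A1)-(A4) of the context, with the same constants $c_1,c_2>0$ in (A2) for all $i$. Assume that the solution set $F=\bigcap_{i=1}^N EP(f_i)$ is nonempty. Let $x_0\in H$ and let $\{x_n\}$, $\{y_n\}$, $\{z_n\}$ be the sequences generated by the cyclic hybrid extragradient-cutting algorithm described in the context. Then $\{x_n\}$, $\{y_n\}$ and $\{z_n\}$ converge strongly to $P_F(x_0)$.
   Context: $P_C$ denotes the metric projection of $H$ onto a nonempty closed convex set $C$. For each $i$, $EP(f_i)$ is the set of $x^*\in K_i$ such that $f_i(x^*,y)\ge 0$ for all $y\in K_i$. For an integer $n\ge0$, $[n]=(n \bmod N)+1\in\{1,\ldots,N\}$. Conditions on each $f_i$: (A1) $f_i$ is pseudomonotone on $H$: for all $x,y\in H$, $f_i(x,y)\ge 0$ implies $f_i(y,x)\le 0$. (A2) $f_i$ is Lipschitz-type continuous: $f_i(x,y)+f_i(y,z)\ge f_i(x,z)-c_1\|x-y\|^2-c_2\|y-z\|^2$ for all $x,y,z\in H$, with constants $c_1,c_2>0$. (A3) $f_i$ is weakly continuous on $H\times H$ (if $x_n\rightharpoonup x$ and $y_n\rightharpoonup y$ weakly in $H$, then $f_i(x_n,y_n)\to f_i(x,y)$). (A4) For every fixed $x\in H$, $f_i(x,\cdot)$ is convex and subdifferentiable on $H$. Cyclic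 hybrid extragradient-cutting algorithm. Parameters: real numbers $\lambda,\mu$, $\epsilon\in(0,\frac12]$, and $\lambda_n,\gamma_n$ with $0<\lambda\le\lambda_n\le\mu<\min\{\frac{1}{2c_1},\frac{1}{2c_2}\}$ and $\gamma_n\in[\epsilon,\frac12]$ for all $n\ge0$. Start with $x_0\in H$. For $n=0,1,2,\ldots$: Step 1. $y_n=\arg\min\{\lambda_n f_{[n]}(x_n,y)+\frac12\|x_n-y\|^2: y\in K_{[n]}\}$. Step 2. $z_n=\arg\min\{\lambda_n f_{[n]}(y_n,y)+\frac12\|x_n-y\|^2: y\in K_{[n]}\}$. Step 3. $x_{n+1}=P_{H_n\cap W_n}(x_0)$, where $H_n=\{z\in H:\langle x_n-z_n,\, z-x_n-\gamma_n(z_n-x_n)\rangle\le 0\}$ and $W_n=\{z\in H:\langle x_0-x_n,\, x_n-z\rangle\ge 0\}$. *)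

(* Defs.v *)
From mathcomp Require Import all_boot all_order all_algebra.
From mathcomp Require Import all_classical all_reals all_analysis.

Set Implicit Arguments.
Unset Strict Implicit.
Unset Printing Implicit Defensive.

Import Order.TTheory GRing.Theory Num.Theory.
Import numFieldNormedType.Exports.

Local Open Scope classical_set_scope.
Local Open Scope ring_scope.

(* A real Hilbert space is rendered as a complete normed module [H] over
   [R : realType] together with an inner product [dot : {dot H for idfun}]
   inducing its norm, i.e. such that [dot x x = `|x| ^+ 2]. *)

Section Hilbert.
Context {R : realType} {H : completeNormedModType R}.
Variable dot : {dot H for idfun}.

Definition weak_cvg (u : nat -> H) (l : H) : Prop :=
  forall v : H, dot (u n) v @[n --> \oo] --> dot l v.

Definition subdifferential (g : H -> R) (y : H) : set H :=
  [set w | forall z, g y + dot w (z - y) <= g z].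

Definition subdifferentiable (g : H -> R) : Prop :=
  forall y, subdifferential g y !=set0.

Definition argmin_on (K : set H) (g : H -> R) : set H :=
  [set y | K y /\ forall z, K z -> g y <= g z].

(* [is_metric_proj C x p] stands for [p = P_C x]; the nearest point is unique
   when [C] is convex. *)
Definition is_metric_proj (C : set H) (x p : H) : Prop :=
  C p /\ forall z, C z -> `|x - p| <= `|x - z|.

Definition EP (K : set H) (f : H -> H -> R) : set H :=
  [set x | K x /\ forall y, K y -> 0 <= f x y].

Definition pseudomonotone (f : H -> H -> R) : Prop :=
  forall x y, 0 <= f x y -> f y x <= 0.

Definition Lipschitz_type (c1 c2 : R) (f : H -> H -> R) : Prop :=
  forall x y z,
    f x z - c1 * `|x - y| ^+ 2 - c2 * `|y - z| ^+ 2 <= f x y + f y z.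

Definition weakly_continuous (f : H -> H -> R) : Prop :=
  forall (u v : nat -> H) (x y : H),
    weak_cvg u x -> weak_cvg v y -> f (u n) (v n) @[n --> \oo] --> f x y.

Definition convex_subdifferentiable_snd (f : H -> H -> R) : Prop :=
  forall x, convex_function [set: convex_lmodType H] (f x) /\
            subdifferentiable (f x).

Definition extragradient_objective (f : H -> H -> R) (lam : R) (u x y : H) : R :=
  lam * f u y + 2^-1 * `|x - y| ^+ 2.

Definition cut_H (gam : R) (x z : H) : set H :=
  [set v | dot (x - z) (v - x - gam *: (z - x)) <= 0].

Definition cut_W (x0 x : H) : set H := [set v | 0 <= dot (x0 - x) (x - v)].

End Hilbert.

(* Indices are 0-based: [cyc N_gt0 n : 'I_N] is [n mod N], which stands for the
   index [(n mod N) + 1] in [{1, ..., N}]. *)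
Definition cyc (N : nat) (N_gt0 : (0 < N)%N) (n : nat) : 'I_N :=
  Ordinal (ltn_pmod n N_gt0).

(* Main.v *)
(** The extragradient inequality shows that [z n] is at least as close as [x n] to
    each solution, so the solution set [F] lies in every [H_n], and by induction in
    every [W_n]. Since [x n] is the projection of [x0] onto [W_n], the distances
    [`|x n - x0|] increase and are bounded by the distance from [x0] to any point of
    [F]; hence [x n.+1 - x n], and then [x n - z n] and [x n - y n], tend to 0.
    Let [p] be the weak limit of a subsequence of [x]. Moving each of its indices by
    fewer than [N] steps gives, for each [i], a subsequence with the same weak limit
    along which the [i]-th bifunction is the active one, so [p] is in [F]. Finally
    [p] in [W_n] gives [`|x n - p| ^+ 2 <= `|p - x0| ^+ 2 - `|x n - x0| ^+ 2], and
    weak lower semicontinuity of the norm makes the right-hand side tend to 0. *)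

From HB Require Import structures.
Require Import Defs.
From mathcomp Require Import all_boot all_order all_algebra ring lra.
From mathcomp Require Import all_classical all_reals all_analysis.

Set Implicit Arguments.
Unset Strict Implicit.
Unset Printing Implicit Defensive.

Import Order.TTheory GRing.Theory Num.Theory.
Import numFieldNormedType.Exports.

Local Open Scope classical_set_scope.
Local Open Scope ring_scope.

(** * Optimality along segments, convexity and limits of real sequences *)

(** The first-order condition behind every variational inequality below, where [t] is the position
    on a segment leaving a minimizer. *)
Lemma ge0_of_quadratic (R : realFieldType) (a b : R) :
  (forall t, 0 < t <= 1 -> 0 <= t * a + t ^+ 2 * b) -> 0 <= a.
Proof.
move=> ab; rewrite leNgt; apply/negP => a0.
have d0 : 0 < `|b| + 1 - a by have := normr_ge0 b; lra.
(* If [a < 0], this [t] makes [a + t * b] at most [- t * (1 - a) < 0], so a single value replaces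
   the limit at 0. *)
pose t := - a / (`|b| + 1 - a).
have t01 : 0 < t <= 1.
  rewrite /t divr_gt0 ?oppr_gt0//= ler_pdivrMr// mul1r.
  by have := normr_ge0 b; lra.
have /andP[t0 _] := t01.
have := ab _ t01; rewrite expr2 -mulrA -mulrDr pmulr_rge0// leNgt => /negP; apply.
have : t * b <= t * `|b| by rewrite ler_pM2l// ler_norm.
have td : t * (`|b| + 1 - a) = - a by rewrite /t divfK// gt_eqF.
nra.
Qed.

Lemma ltr_of_sqr (R : realDomainType) (a b : R) :
  0 <= b -> a ^+ 2 < b ^+ 2 -> a < b.
Proof.
move=> b0; rewrite !ltNge; apply: contra => ba.
by rewrite ler_pXn2r ?nnegrE// (le_trans b0).
Qed.

Lemma convex_set_line (R : realFieldType) (M : lmodType R) (C : set M) (u v : M)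
    (t : R) :
  convex_set C -> C u -> C v -> 0 <= t <= 1 -> C (u + t *: (v - u)).
Proof.
move=> C_convex Cu Cv /andP[t0 t1].
have -> : u + t *: (v - u) = t *: v + (1 - t) *: u.
  by rewrite scalerBl scale1r scalerBr addrCA.
exact: set_mem (C_convex v u (Itv01 t0 t1) (mem_set Cv) (mem_set Cu)).
Qed.

Lemma convex_function_line (R : realFieldType) (M : lmodType R) (g : M -> R)
    (u v : M) (t : R) :
  convex_function [set: convex_lmodType M] g -> 0 <= t <= 1 ->
  g (u + t *: (v - u)) <= g u + t * (g v - g u).
Proof.
move=> g_convex /andP[t0 t1].
have g_le : g (t *: v + (1 - t) *: u) <= t * g v + (1 - t) * g u.
  exact: (g_convex (Itv01 t0 t1) v u (mem_set I) (mem_set I)).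
have -> : u + t *: (v - u) = t *: v + (1 - t) *: u.
  by rewrite scalerBl scale1r scalerBr addrCA.
lra.
Qed.

Lemma cvg_subseq (V : topologicalType) (u : nat -> V) (l : V) (m : nat -> nat) :
  (forall k, k <= m k)%N -> u @ \oo --> l -> u (m k) @[k --> \oo] --> l.
Proof.
move=> m_ge ul; apply: (@cvg_comp _ _ _ m u _ \oo) => //.
apply/cvgnyPge => A; near=> k; apply: leq_trans (m_ge k).
by near: k; exact: nbhs_infty_ge.
Unshelve. all: by end_near. Qed.

Lemma sqr_cvg0 (R : realType) (u v : nat -> R) : v @ \oo --> (0 : R) ->
  (forall n, u n ^+ 2 <= v n) -> u @ \oo --> (0 : R).
Proof.
move=> /cvgr0Pnorm_lt v0 uv; apply/cvgr0Pnorm_lt => e e0; near=> n.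
apply: (@ltr_of_sqr R); first exact: ltW.
rewrite -normrX ger0_norm ?sqr_ge0//; apply: le_lt_trans (uv n) _.
apply: le_lt_trans (ler_norm _) _.
by near: n; apply: v0; rewrite exprn_gt0.
Unshelve. all: by end_near. Qed.

(** * Inner product identities and minimization over closed convex sets *)

Section InnerProduct.
Context {R : realType} {H : completeNormedModType R} (dot : {dot H for idfun}).
Hypothesis dot_norm : forall x : H, dot x x = `|x| ^+ 2.
Implicit Types (u v w p : H) (C : set H).

Lemma dotC u v : dot u v = dot v u.
Proof. by rewrite hermitian_subproof expr0 mul1r. Qed.

Lemma dotZl a u v : dot (a *: u) v = a * dot u v.
Proof. exact: linearZl_LR. Qed.

Lemma dotZr a u v : dot u (a *: v) = a * dot u v.
Proof. exact: linearZr_LR. Qed.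

(* Restated so that the results display [dot] itself and not its coercion to a
   bilinear form, which [rewrite] and [ring] would keep apart. *)
Lemma dotDl u v w : dot (u + v) w = dot u w + dot v w.
Proof. exact: linearDl. Qed.

Lemma dotDr u v w : dot u (v + w) = dot u v + dot u w.
Proof. exact: linearDr. Qed.

Lemma dotBl u v w : dot (u - v) w = dot u w - dot v w.
Proof. exact: linearBl. Qed.

Lemma dotBr u v w : dot u (v - w) = dot u v - dot u w.
Proof. exact: linearBr. Qed.

Lemma dotNl u v : dot (- u) v = - dot u v.
Proof. exact: linearNl. Qed.

Lemma dotNr u v : dot u (- v) = - dot u v.
Proof. exact: linearNr. Qed.

Definition dotE := (dotDl, dotDr, dotNl, dotNr, dotZl, dotZr).

Lemma ler_norm_dot u v : `|dot u v| <= `|u| * `|v|.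
Proof.
have [->|u0] := eqVneq u 0; first by rewrite linear0l !normr0 mul0r.
have [->|v0] := eqVneq v 0; first by rewrite linear0r !normr0 mulr0.
have uv0 : 0 < 2 * (`|u| * `|v|) by rewrite !mulr_gt0 ?normr_gt0.
have := sqr_ge0 `|(`|v| *: u) - (`|u| *: v)|.
have := sqr_ge0 `|(`|v| *: u) + (`|u| *: v)|.
rewrite -!dot_norm !dotE !dot_norm [dot v u]dotC => h1 h2.
by rewrite ler_norml; apply/andP; split; rewrite -(ler_pM2l uv0); lra.
Qed.

Lemma parallelogram u v :
  `|u - v| ^+ 2 = 2 * `|u| ^+ 2 + 2 * `|v| ^+ 2 - `|u + v| ^+ 2.
Proof. rewrite -!dot_norm !dotE [dot v u]dotC; ring. Qed.

Lemma sqr_normB u v : `|u - v| ^+ 2 = `|u| ^+ 2 + `|v| ^+ 2 - 2 * dot u v.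
Proof. rewrite -!dot_norm !dotE [dot v u]dotC; ring. Qed.

Lemma sqr_normD u v : `|u + v| ^+ 2 = `|u| ^+ 2 + `|v| ^+ 2 + 2 * dot u v.
Proof. rewrite -!dot_norm !dotE [dot v u]dotC; ring. Qed.

(* With [C] the whole space this is the Riesz representation theorem; with
   [phi = dot a] it is the existence of the projection of [a] onto [C]. *)
Lemma quadratic_minimizer C (phi : H -> R) (M : R) :
  scalar phi -> closed C -> convex_set C -> C !=set0 ->
  (forall u, `|phi u| <= M * `|u|) ->
  exists2 p, C p & forall v, C v -> phi (v - p) <= dot p (v - p).
Proof.
move=> phi_scalar C_closed C_convex [c Cc].
pose psi : {scalar H} := HB.pack phi (GRing.isLinear.Build _ _ _ _ phi phi_scalar).
rewrite -[phi]/(psi : H -> R) => phi_le.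
move: psi phi_le => {phi_scalar}{}phi phi_le.
(* When [phi = dot a], this is the squared distance to [a] up to a constant. *)
pose J u : R := `|u| ^+ 2 - 2 * phi u.
have J_inf : has_inf [set J u | u in C].
  split; first by exists (J c), c.
  exists (- M ^+ 2) => _ [u _ <-]; rewrite /J.
  have := sqr_ge0 (`|u| - M); have := phi_le u; rewrite ler_norml => /andP[_].
  lra.
pose m := inf [set J u | u in C].
have m_le u : C u -> m <= J u.
  by move=> Cu; apply: ge_inf; [case: J_inf|exists u].
have near_inf n : exists u, C u /\ J u < m + n.+1%:R^-1.
  have [|_ [u Cu <-] uJ] := inf_adherent (eps := n.+1%:R^-1 : R) _ J_inf.
    by rewrite invr_gt0.
  by exists u.
have [a /all_and2[Ca Ja]] := choice near_inf.
(* The parallelogram law at the midpoint, which lies in [C] and so has value at least [m]. It makes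
   minimizing sequences Cauchy. *)
have J_strict u v : C u -> C v -> `|u - v| ^+ 2 <= 2 * (J u - m) + 2 * (J v - m).
  move=> Cu Cv.
  have midE : u + 2^-1 *: (v - u) = 2^-1 *: (u + v).
    rewrite scalerBr scalerDr addrA addrAC; congr (_ + _).
    by rewrite -{1}[u]scale1r -scalerBl; congr (_ *: _); field.
  have m_mid : m <= J (2^-1 *: (u + v)).
    by rewrite -midE; apply: m_le; apply: convex_set_line => //; lra.
  have JE : J (2^-1 *: (u + v)) = 4^-1 * `|u + v| ^+ 2 - (phi u + phi v).
    rewrite /J [phi _]linearZ [phi (u + v)]linearD/= normrZ ger0_norm ?invr_ge0//.
    by rewrite exprMn; field.
  by rewrite parallelogram; move: m_mid; rewrite JE /J; lra.
have a_cvg : cvg (a @ \oo).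
  apply: cauchy_cvg; apply: cauchy_exP => e e0.
  have e20 : 0 < e ^+ 2 / 4 by rewrite divr_gt0 ?exprn_gt0.
  have [k _ /(_ _ (leqnn _)) /= ke] := near_infty_natSinv_lt (PosNum e20).
  exists (a k); exists k => // n /= kn; rewrite -ball_normE /=.
  apply: (@ltr_of_sqr R); first exact: ltW.
  apply: le_lt_trans (J_strict _ _ (Ca k) (Ca n)) _.
  have : n.+1%:R^-1 <= k.+1%:R^-1 :> R by rewrite lef_pV2 ?posrE// ler_nat.
  have := Ja k; have := Ja n.
  by move: (n.+1%:R^-1) (k.+1%:R^-1) ke (J (a n)) (J (a k)) => *; lra.
set p := lim (a @ \oo) in a_cvg.
have Cp : C p by apply: (closed_cvg _ C_closed _ _ a_cvg); near=> n; exact: Ca.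
have Jp u : C u -> J p <= J u.
  move=> Cu; apply: le_trans (m_le _ Cu).
  have phi_cvg : phi (a n) @[n --> \oo] --> phi p.
    apply/cvgrPdist_lt => e e0; near=> n; rewrite -linearB/=.
    apply: le_lt_trans (phi_le _) _.
    apply: (@le_lt_trans _ _ ((`|M| + 1) * `|p - a n|)).
      by rewrite ler_wpM2r//; have := ler_norm M; lra.
    rewrite -ltr_pdivlMl; last by have := normr_ge0 M; lra.
    near: n; move/cvgrPdist_lt : a_cvg; apply.
    by rewrite mulr_gt0// invr_gt0; have := normr_ge0 M; lra.
  have J_cvg : J (a n) @[n --> \oo] --> J p.
    apply: cvgB; last exact: cvgM (cvg_cst _) phi_cvg.
    by apply: cvgM; exact: cvg_norm.
  have m_cvg : m + n.+1%:R^-1 @[n --> \oo] --> m.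
    by rewrite -[X in _ --> X]addr0; apply: cvgD; [exact: cvg_cst|exact: cvg_harmonic].
  apply: ler_cvg_to J_cvg m_cvg _.
  by near=> n; exact: ltW (Ja n).
exists p => // v Cv; rewrite -subr_ge0 -(pmulr_rge0 _ (ltr0n _ 2)).
apply: (@ge0_of_quadratic _ _ (`|v - p| ^+ 2)) => t /andP[t0 t1].
have t01 : 0 <= t <= 1 by rewrite ltW.
have := Jp _ (convex_set_line C_convex Cp Cv t01).
rewrite /J [`|p + _| ^+ 2]sqr_normD dotZr [phi (p + _)]linearD [phi (t *: _)]linearZ/=.
rewrite normrZ exprMn (ger0_norm (ltW t0)).
lra.
Unshelve. all: by end_near. Qed.

End InnerProduct.

(** * Convergence along ultrafilters *)

Lemma ultra_fmap (T U : Type) (f : T -> U) (F : set_system T) :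
  UltraFilter F -> UltraFilter (f @ F).
Proof.
move=> FU; split; first exact: fmap_proper_filter.
move=> G GF FG; rewrite predeqE => A; split; last exact: FG.
move=> GA; have [//|FnA] := in_ultra_setVsetC (f @^-1` A) FU.
have /filter_ex[x [Ax]] : G (A `&` ~` A) by apply: filterI => //; exact: FG.
by [].
Qed.

(** If the preimage of a neighbourhood of [l] were not in [F], the trace of [F] on its complement
    would be proper, and an ultrafilter refining that trace would contain both sets. *)
Lemma ultra_cvg (T : Type) (U : topologicalType) (F : set_system T) (a : T -> U)
    (l : U) :
  Filter F ->
  (forall V, UltraFilter V -> F `<=` V -> a @ V --> l) -> a @ F --> l.
Proof.
move=> FF a_ultra B lB; apply: contrapT => nFB.
pose D := ~` (a @^-1` B).
have DF : ProperFilter (within D F).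
  apply: Build_ProperFilter_ex => A FA; apply: contrapT => nA; apply: nFB.
  apply: (@filterS _ F _ _ _ _ FA) => t tA; apply: contrapT => Dt; apply: nA.
  by exists t; exact: tA.
have [V [VU DV]] := ultraFilterLemma DF.
have FV : F `<=` V by move=> A FA; apply: DV; exact: (@cvg_within _ F _ D).
have := a_ultra V VU FV B lB; rewrite /= nbhs_filterE => VB.
have VD : V D := DV _ (withinT D FF).
have /filter_ex[t []] : V (a @^-1` B `&` D) by exact: filterI.
by [].
Qed.

Lemma ultra_bounded_is_cvg (R : realType) (T : Type) (F : set_system T) (a : T -> R)
    M :
  UltraFilter F -> (forall t, `|a t| <= M) -> cvg (a @ F).
Proof.
move=> FU aM; have := @segment_compact R (- M) M; rewrite compact_ultra.
move=> /(_ _ (ultra_fmap a FU)) [|l [_ al]]; last by apply/cvg_ex; exists l.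
by apply: nearW => t; rewrite /= in_itv/= -ler_norml.
Qed.

(** * Weak compactness of bounded sequences and weak closedness of convex sets *)

Section WeakCompactness.
Context {R : realType} {H : completeNormedModType R} (dot : {dot H for idfun}).
Hypothesis dot_norm : forall x : H, dot x x = `|x| ^+ 2.

(** An ultrafilter gives the limits of [dot (w n) v] for all [v] at once. They form a bounded linear
    functional of [v], which Riesz representation turns into a vector. *)
Lemma ultra_weak_cvg (F : set_system nat) (w : nat -> H) M :
  UltraFilter F -> (forall n, `|w n| <= M) ->
  exists q, forall v, dot (w n) v @[n --> F] --> dot q v.
Proof.
move=> FU wM; pose phi v := lim (dot (w n) v @[n --> F]).
have w_le n v : `|dot (w n) v| <= M * `|v|.
  by apply: le_trans (ler_norm_dot dot_norm _ _) _; rewrite ler_wpM2r.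
have phi_cvg v : dot (w n) v @[n --> F] --> phi v.
  exact: ultra_bounded_is_cvg (w_le^~ v).
have phi_scalar : scalar phi.
  move=> a u v; apply: (cvg_lim (@Rhausdorff R)).
  under eq_fun do rewrite dotDr dotZr.
  by apply: cvgD => //; apply: cvgM => //; exact: cvg_cst.
have phi_le v : `|phi v| <= M * `|v|.
  by apply: cvgr_to_le (cvg_norm (phi_cvg v)) _; apply: nearW => n; exact: w_le.
have convexT : convex_set [set: H] by move=> u v t _ _; rewrite inE.
have [q _ q_le] := quadratic_minimizer dot_norm phi_scalar closedT convexT
  (ex_intro _ 0 I) phi_le.
exists q => v; suff -> : dot q v = phi v by exact: phi_cvg.
have phi0 u : phi (- u) = - phi u.
  pose psi : {scalar H} := HB.pack phi (GRing.isLinear.Build _ _ _ _ phi phi_scalar).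
  by rewrite -[phi]/(psi : H -> R) linearN.
(* Testing at [q + v] and [q - v] turns the variational inequality into an equality. *)
have := q_le (q + v) I; have := q_le (q - v) I.
have subqK u : q + u - q = u by rewrite addrAC subrr add0r.
rewrite !subqK phi0 dotNr lerN2 => h1 h2.
by apply/eqP; rewrite eq_le h1 h2.
Qed.

(* The subsequence is chosen so that [w (s k)], with [w = x - p], becomes orthogonal to
   each [w m]. A weak limit [q] of it along an ultrafilter is then orthogonal to
   each [w m], hence to itself. *)
Lemma bounded_weak_subsequence (x : nat -> H) M :
  (forall n, `|x n| <= M) ->
  exists p (s : nat -> nat), (forall k, k <= s k)%N /\ weak_cvg dot (x \o s) p.
Proof.
move=> xM.
have [U [UU ooU]] := ultraFilterLemma (eventually_filter).
have [p xp] := ultra_weak_cvg UU xM.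
pose w n := x n - p.
have wU v : dot (w n) v @[n --> U] --> 0.
  rewrite /w; under eq_fun do rewrite dotBl.
  rewrite -(subrr (dot p v)); apply: cvgB => //; exact: cvg_cst.
have s_ex k : exists n, (k <= n)%N /\
    forall m, (m <= k)%N -> `|dot (w n) (w m)| < k.+1%:R^-1.
  (* Each orthogonality condition holds [U]-eventually, hence so do finitely many of them
     together. *)
  have UK K : \forall n \near U, forall m, (m < K)%N -> `|dot (w n) (w m)| < k.+1%:R^-1.
    elim: K => [|K IH]; first exact: nearW.
    have /cvgr0Pnorm_lt/(_ k.+1%:R^-1) := wU (w K).
    rewrite invr_gt0 ltr0n => /(_ isT) wK.
    near=> n => m; rewrite ltnS leq_eqVlt => /predU1P[->|]; first by near: n.
    by move: m; near: n.
  have Uk : \forall n \near U, (k <= n)%N by apply: ooU; exact: nbhs_infty_ge.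
  near U => n; exists n; split; first by near: n.
  by near: n; exact: (UK k.+1).
have [s /all_and2[s_ge s_orth]] := choice s_ex.
(* The limit [q] found below may a priori depend on [V]; showing that it is always 0 gives
   convergence along the whole sequence. *)
exists p, s; split=> // v; apply: ultra_cvg => V VU ooV.
have wM n : `|w (s n)| <= M + `|p|.
  by apply: le_trans (ler_normB _ _) _; rewrite lerD2r.
have [q wq] := ultra_weak_cvg VU wM.
have q_orth m : dot q (w m) = 0.
  have wm0 : dot (w (s k)) (w m) @[k --> V] --> (0 : R).
    apply/cvgr0Pnorm_lt => e e0; apply: ooV; near=> k.
    apply: lt_trans (s_orth k m _) _; first by near: k; exact: nbhs_infty_ge.
    by near: k; exact: (near_infty_natSinv_lt (PosNum e0)).
  exact: (cvg_unique (@Rhausdorff R) (wq (w m)) wm0).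
have q0 : q = 0.
  have wq0 : dot (w (s k)) q @[k --> V] --> (0 : R).
    by under eq_fun do rewrite dotC q_orth; exact: cvg_cst.
  have qq0 : dot q q = 0 := cvg_unique (@Rhausdorff R) (wq q) wq0.
  by apply/eqP; rewrite -normr_eq0 -sqrf_eq0 -dot_norm qq0.
have := wq v; rewrite q0 linear0l => wv0.
have -> : (fun n => dot ((x \o s) n) v) = (fun n => dot (w (s n)) v + dot p v).
  by apply/funext => n /=; rewrite /w dotBl subrK.
by rewrite -[X in _ --> X]add0r; apply: cvgD => //; exact: cvg_cst.
Unshelve. all: by end_near. Qed.

(** With [q] the projection of [p] onto [C], the obtuse-angle inequality at [u n] passes to the weak
    limit and forces [dot (p - q) (p - q) <= 0]. *)
Lemma weak_closed (C : set H) (u : nat -> H) p :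
  closed C -> convex_set C -> (forall n, C (u n)) -> weak_cvg dot u p -> C p.
Proof.
move=> C_closed C_convex Cu up.
have C0 : C !=set0 by exists (u 0%N).
have dot_scalar : scalar (dot p) by move=> a v w; rewrite dotDr dotZr.
have [q Cq q_le] := quadratic_minimizer dot_norm dot_scalar C_closed C_convex
  C0 (ler_norm_dot dot_norm p).
suff -> : p = q by [].
apply/eqP; rewrite -subr_eq0 -normr_eq0 -sqrf_eq0 -dot_norm eq_le dot_norm sqr_ge0.
rewrite andbT -dot_norm dotBr [dot _ p]dotC dotBr.
have := up (p - q).
move=> upq.
have : dot p (p - q) <= dot q (p - q).
  apply: cvgr_to_le upq _; apply: nearW => n.
  by have := q_le _ (Cu n); rewrite !dotE ![dot _ (u n)]dotC [dot q p]dotC; lra.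
by rewrite !dotE [dot q p]dotC; lra.
Qed.

End WeakCompactness.

(** * One step of the algorithm: extragradient estimates, cuts and weak limits *)

(** At three equal points the Lipschitz-type inequality reads [f x x <= f x x + f x x], so [f x x]
    is nonnegative; pseudomonotonicity gives the other sign. *)
Lemma pseudomonotone_Lipschitz_diag (R : realType) (H : completeNormedModType R)
    (f : H -> H -> R) c1 c2 x :
  pseudomonotone f -> Lipschitz_type c1 c2 f -> f x x = 0.
Proof.
move=> f_mono /(_ x x x); rewrite subrr normr0 expr0n/= !mulr0 !subr0 => fxx.
have fxx0 : 0 <= f x x by lra.
by apply/eqP; rewrite eq_le fxx0 f_mono.
Qed.

Section ExtragradientStep.
Context {R : realType} {H : completeNormedModType R} (dot : {dot H for idfun}).
Hypothesis dot_norm : forall x : H, dot x x = `|x| ^+ 2.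
Implicit Types (u v x y z p : H) (K : set H) (f : H -> H -> R).

(* Compare the minimizer [y] with the points [y + t (v - y)] and let [t] tend to 0. *)
Lemma argmin_variational K f lam u x y v :
  convex_set K -> convex_function [set: convex_lmodType H] (f u) -> 0 <= lam ->
  argmin_on K (extragradient_objective f lam u x) y -> K v ->
  dot (y - x) (y - v) <= lam * (f u v - f u y).
Proof.
move=> K_convex f_convex lam0 [Ky y_min] Kv; rewrite -subr_ge0.
apply: (@ge0_of_quadratic _ _ (2^-1 * `|v - y| ^+ 2)) => t /andP[t0 t1].
have t01 : 0 <= t <= 1 by rewrite ltW.
have := y_min _ (convex_set_line K_convex Ky Kv t01).
have := ler_wpM2l lam0 (convex_function_line y v f_convex t01).
rewrite /extragradient_objective -!dot_norm !dotE.
rewrite ?[dot y x]dotC ?[dot v x]dotC ?[dot v y]dotC.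
lra.
Qed.

(** Add the variational inequality of [y] tested at [z], that of [z] tested at [v], the
    Lipschitz-type inequality at [x], [y], [z], and [f y v <= 0], which pseudomonotonicity gives
    since [v] is a solution. *)
Lemma extragradient_fejer K f c1 c2 lam x y z v :
  convex_set K -> pseudomonotone f -> Lipschitz_type c1 c2 f ->
  convex_subdifferentiable_snd dot f -> 0 <= lam ->
  argmin_on K (extragradient_objective f lam x x) y ->
  argmin_on K (extragradient_objective f lam y x) z -> EP K f v ->
  `|z - v| ^+ 2 <= `|x - v| ^+ 2 - (1 - 2 * lam * c1) * `|x - y| ^+ 2
                   - (1 - 2 * lam * c2) * `|y - z| ^+ 2.
Proof.
move=> K_convex f_mono f_Lip f_convex lam0 y_min z_min [Kv v_eq].
have [[Ky _] [Kz _]] := (y_min, z_min).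
have fyv : f y v <= 0 by apply/f_mono/v_eq.
have := argmin_variational K_convex (f_convex x).1 lam0 y_min Kz.
have := argmin_variational K_convex (f_convex y).1 lam0 z_min Kv.
have := ler_wpM2l lam0 (f_Lip x y z); have := ler_wpM2l lam0 fyv.
rewrite -!dot_norm !dotE ?[dot y x]dotC ?[dot z x]dotC ?[dot v x]dotC.
rewrite ?[dot z y]dotC ?[dot v y]dotC ?[dot v z]dotC.
lra.
Qed.

(** For [gam = 1/2] the cut is exactly the set of points at least as close to [z] as to [x]; a
    smaller [gam] enlarges it. *)
Lemma cut_H_mem gam x z v :
  gam <= 1 / 2 -> `|z - v| ^+ 2 <= `|x - v| ^+ 2 -> cut_H dot gam x z v.
Proof.
move=> gam_le zv; rewrite /cut_H/=.
have : (1 / 2 - gam) * `|x - z| ^+ 2 >= 0 by rewrite mulr_ge0 ?subr_ge0.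
move: zv; rewrite -!dot_norm !dotE ?[dot z x]dotC ?[dot v x]dotC ?[dot v z]dotC.
lra.
Qed.

(** Cauchy-Schwarz in the inequality defining the cut, divided by the norm of [x - z]. Applied to
    the next iterate, it bounds [x - z] by the step length. *)
Lemma cut_H_dist eps gam x z v : eps <= gam -> cut_H dot gam x z v ->
  eps * `|x - z| <= `|v - x|.
Proof.
move=> eps_le; rewrite /cut_H/=.
have [->|xz0] := eqVneq x z; first by rewrite subrr normr0 mulr0.
have dist_gt0 : 0 < `|x - z| by rewrite normr_gt0 subr_eq0.
have -> : dot (x - z) (v - x - gam *: (z - x))
    = dot (x - z) (v - x) + gam * `|x - z| ^+ 2.
  by rewrite -!dot_norm !dotE; ring.
have := ler_norm_dot dot_norm (x - z) (v - x); rewrite ler_norml => /andP[+ _].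
move=> h1 h2; rewrite -(ler_pM2l dist_gt0).
have := ler_wpM2r (sqr_ge0 `|x - z|) eps_le.
rewrite expr2; lra.
Qed.

(** The triangle [x0], [x], [v] has a right or obtuse angle at [x]. *)
Lemma cut_W_dist x0 x v : cut_W dot x0 x v ->
  `|x - v| ^+ 2 <= `|v - x0| ^+ 2 - `|x - x0| ^+ 2.
Proof.
rewrite /cut_W/= -!dot_norm !dotE.
rewrite ?[dot v x]dotC ?[dot v x0]dotC ?[dot x0 x]dotC; lra.
Qed.

Lemma metric_proj_cut_W (C : set H) x0 p v :
  (forall t, 0 <= t <= 1 -> C (p + t *: (v - p))) ->
  is_metric_proj C x0 p -> cut_W dot x0 p v.
Proof.
move=> C_line [_ p_min]; rewrite /cut_W/= -(pmulr_rge0 _ (ltr0n _ 2)).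
apply: (@ge0_of_quadratic _ _ (`|v - p| ^+ 2)) => t /andP[t0 t1].
have t01 : 0 <= t <= 1 by rewrite ltW.
have := p_min _ (C_line _ t01); rewrite -ler_sqr ?nnegrE// -!dot_norm !dotE.
rewrite ?[dot v p]dotC ?[dot v x0]dotC ?[dot p x0]dotC; lra.
Qed.

Lemma cut_line gam x0 x z u v t : 0 <= t <= 1 ->
  (cut_H dot gam x z `&` cut_W dot x0 x) u ->
  (cut_H dot gam x z `&` cut_W dot x0 x) v ->
  (cut_H dot gam x z `&` cut_W dot x0 x) (u + t *: (v - u)).
Proof.
move=> /andP[t0 t1]; rewrite /cut_H /cut_W /= => -[Hu Wu] [Hv Wv].
have s0 : 0 <= 1 - t by rewrite subr_ge0.
split.
  have := ler_wpM2l s0 Hu; have := ler_wpM2l t0 Hv; rewrite !dotE; lra.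
have := ler_wpM2l s0 Wu; have := ler_wpM2l t0 Wv; rewrite !dotE; lra.
Qed.

Lemma weak_cvg_cst p : weak_cvg dot (fun=> p) p.
Proof. by move=> v; exact: cvg_cst. Qed.

Lemma weak_cvg_perturb (a b : nat -> H) p : weak_cvg dot a p ->
  `|b n - a n| @[n --> \oo] --> (0 : R) -> weak_cvg dot b p.
Proof.
move=> ap ba0 v.
have bE : (fun n => dot (b n) v) = (fun n => dot (b n - a n) v + dot (a n) v).
  by apply/funext => n; rewrite dotDl dotNl subrK.
rewrite bE -[X in _ --> X]add0r; apply: cvgD; last exact: ap.
apply: norm_cvg0.
apply: (@squeeze_cvgr _ _ _ _ (fun=> 0) (fun n => `|b n - a n| * `|v|)).
- by apply: nearW => n; rewrite normr_ge0 ler_norm_dot.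
- exact: cvg_cst.
- by rewrite -[X in _ --> X](mul0r `|v|); apply: cvgM => //; exact: cvg_cst.
Qed.

(** The variational inequality of [b n] tested at [v] bounds [lam_ n * (f (a n) (b n) - f (a n) v)]
    by a null sequence, while [f (a n) (b n)] tends to [f p p = 0] by weak continuity. *)
Lemma EP_weak_limit K f c1 c2 lam (lam_ : nat -> R) (a b : nat -> H) p M :
  closed K -> convex_set K -> pseudomonotone f -> Lipschitz_type c1 c2 f ->
  weakly_continuous dot f -> convex_subdifferentiable_snd dot f ->
  0 < lam -> (forall n, lam <= lam_ n) ->
  (forall n, argmin_on K (extragradient_objective f (lam_ n) (a n) (a n)) (b n)) ->
  (forall n, `|a n| <= M) -> weak_cvg dot a p ->
  `|b n - a n| @[n --> \oo] --> (0 : R) -> EP K f p.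
Proof.
move=> K_closed K_convex f_mono f_Lip f_cont f_convex lam0 lam_le b_min aM ap ba0.
have bp := weak_cvg_perturb ap ba0.
split.
  by apply: weak_closed dot_norm _ _ _ K_closed K_convex _ bp => n; case: (b_min n).
move=> v Kv.
have fab : f (a n) (b n) @[n --> \oo] --> (0 : R).
  by rewrite -(pseudomonotone_Lipschitz_diag p f_mono f_Lip); exact: f_cont.
have fav : f (a n) v @[n --> \oo] --> f p v.
  by apply: f_cont => //; exact: weak_cvg_cst.
pose g n := `|b n - a n| * (`|b n - a n| + (M + `|v|)).
have g0 : g n @[n --> \oo] --> (0 : R).
  rewrite -[X in _ --> X](mul0r (0 + (M + `|v|))).
  by apply: cvgM => //; apply: cvgD => //; exact: cvg_cst.
have lam_fp : lam * (f (a n) (b n) - f (a n) v) @[n --> \oo] --> lam * (0 - f p v).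
  by apply: cvgM; [exact: cvg_cst|exact: cvgB].
suff : lam * (0 - f p v) <= 0 by rewrite pmulr_rle0// sub0r oppr_le0.
apply: ler_cvg_to lam_fp g0 _; apply: nearW => n.
have g_ge : lam_ n * (f (a n) (b n) - f (a n) v) <= g n.
  have ln0 : 0 <= lam_ n := ltW (lt_le_trans lam0 (lam_le n)).
  have := argmin_variational K_convex (f_convex (a n)).1 ln0 (b_min n) Kv.
  have := ler_norm_dot dot_norm (b n - a n) (b n - v).
  rewrite ler_norml => /andP[+ _].
  have : `|b n - a n| * `|b n - v| <= g n.
    rewrite ler_wpM2l// -[b n - v](subrKA (a n)).
    apply: le_trans (ler_normD _ _) _; rewrite lerD2l.
    by apply: le_trans (ler_normB _ _) _; rewrite lerD2r.
  lra.
have gn0 : 0 <= g n.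
  rewrite mulr_ge0// !addr_ge0//; exact: le_trans (aM n).
(* Since [lam_] need not converge, it is replaced by its lower bound [lam], which is legitimate when
   the difference is positive; otherwise [g n >= 0] suffices. *)
have [D0|D0] := leP (f (a n) (b n) - f (a n) v) 0.
  by apply: le_trans gn0; rewrite pmulr_rle0.
by apply: le_trans g_ge; rewrite ler_pM2r.
Qed.

(** At most [N] consecutive steps, each shorter than [e / N.+1], add up to less than [e]. *)
Lemma cvg_bounded_gap (u : nat -> H) (s m : nat -> nat) N :
  `|u n.+1 - u n| @[n --> \oo] --> (0 : R) ->
  (forall k, k <= s k)%N -> (forall k, s k <= m k <= s k + N)%N ->
  `|u (m k) - u (s k)| @[k --> \oo] --> (0 : R).
Proof.
move=> /cvgr0Pnorm_lt du s_ge m_s; apply/cvgr0Pnorm_lt => e e0.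
have d0 : 0 < e / N.+1%:R by rewrite divr_gt0.
have [n0 _ du_lt] := du _ d0.
exists n0 => // k /= n0k; rewrite normr_id.
have [/andP[sm mN] n0s] := (m_s k, leq_trans n0k (s_ge k)).
have gap j : `|u (s k + j)%N - u (s k)| <= j%:R * (e / N.+1%:R).
  elim: j => [|j IH]; first by rewrite addn0 subrr normr0 mul0r.
  rewrite addnS -(subrKA (u (s k + j)%N)); apply: le_trans (ler_normD _ _) _.
  rewrite -natr1 mulrDl mul1r addrC lerD// ltW//.
  have := du_lt (s k + j)%N (leq_trans n0s (leq_addr _ _)).
  by rewrite /= normr_id.
rewrite -(subnKC sm); apply: le_lt_trans (gap _) _.
rewrite mulrCA gtr_pMr// ltr_pdivrMr// mul1r ltr_nat ltnS.
by rewrite leq_subLR.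
Qed.

End ExtragradientStep.

(** * Strong convergence of the three sequences to the projection *)

Theorem theorem3p10 (R : realType) (H : completeNormedModType R)
    (dot : {dot H for idfun}) (dot_norm : forall x : H, dot x x = `|x| ^+ 2)
    (N : nat) (N_gt0 : (0 < N)%N)
    (K : 'I_N -> set H) (f : 'I_N -> H -> H -> R) (c1 c2 : R)
    (K_closed : forall i, closed (K i))
    (K_convex : forall i, convex_set (K i))
    (K_meet : \bigcap_i K i !=set0)
    (c1_gt0 : 0 < c1) (c2_gt0 : 0 < c2)
    (A1 : forall i, pseudomonotone (f i))
    (A2 : forall i, Lipschitz_type c1 c2 (f i))
    (A3 : forall i, weakly_continuous dot (f i))
    (A4 : forall i, convex_subdifferentiable_snd dot (f i))
    (F_neq0 : \bigcap_i EP (K i) (f i) !=set0)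
    (lam mu eps : R) (lam_ gam_ : nat -> R)
    (lam_gt0 : 0 < lam)
    (lam_bounds : forall n, lam <= lam_ n <= mu)
    (mu_lt : mu < Num.min (1 / (2 * c1)) (1 / (2 * c2)))
    (eps_bounds : 0 < eps <= 1 / 2)
    (gam_bounds : forall n, eps <= gam_ n <= 1 / 2)
    (x0 : H) (x y z : nat -> H)
    (x_0 : x 0%N = x0)
    (step1 : forall n, argmin_on (K (cyc N_gt0 n))
       (extragradient_objective (f (cyc N_gt0 n)) (lam_ n) (x n) (x n)) (y n))
    (step2 : forall n, argmin_on (K (cyc N_gt0 n))
       (extragradient_objective (f (cyc N_gt0 n)) (lam_ n) (y n) (x n)) (z n))
    (step3 : forall n, is_metric_proj
       (cut_H dot (gam_ n) (x n) (z n) `&` cut_W dot x0 (x n)) x0 (x n.+1)) :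
  exists p : H, [/\ is_metric_proj (\bigcap_i EP (K i) (f i)) x0 p,
    x @ \oo --> p, y @ \oo --> p & z @ \oo --> p].
Proof.
set i_ := cyc N_gt0 in step1 step2.
have /andP[eps0 _] := eps_bounds.
have lam_ge0 n : 0 <= lam_ n by have /andP[+ _] := lam_bounds n; lra.
have mu0 : 0 <= mu by have /andP[_] := lam_bounds 0%N; have := lam_ge0 0%N; lra.
have [mu_c1 mu_c2] : 0 < 1 - 2 * mu * c1 /\ 0 < 1 - 2 * mu * c2.
  move: mu_lt; rewrite lt_min !ltr_pdivlMr ?mulr_gt0// => /andP[h1 h2].
  by split; lra.
set F := \bigcap_i EP (K i) (f i) in F_neq0 *.
(* Replacing [lam_ n] by its upper bound [mu] makes the coefficient independent of [n]; the
   [y n - z n] term is dropped. *)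
have fejer n v : F v -> `|z n - v| ^+ 2 + (1 - 2 * mu * c1) * `|x n - y n| ^+ 2
    <= `|x n - v| ^+ 2.
  move=> Fv; have := extragradient_fejer dot_norm (K_convex _) (A1 _) (A2 _) (A4 _)
    (lam_ge0 n) (step1 n) (step2 n) (Fv (i_ n) I).
  have /andP[_ lam_mu] := lam_bounds n.
  have : 0 <= (mu - lam_ n) * c1 * `|x n - y n| ^+ 2.
    by rewrite !mulr_ge0 ?subr_ge0// ltW.
  have : 0 <= (mu - lam_ n) * c2 * `|y n - z n| ^+ 2.
    by rewrite !mulr_ge0 ?subr_ge0// ltW.
  have : 0 <= (1 - 2 * mu * c2) * `|y n - z n| ^+ 2 by rewrite mulr_ge0 ?sqr_ge0// ltW.
  lra.
have F_cut_H n v : F v -> cut_H dot (gam_ n) (x n) (z n) v.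
  move=> Fv; have /andP[_ gam_le] := gam_bounds n.
  apply: cut_H_mem => //; have := fejer n v Fv.
  have : 0 <= (1 - 2 * mu * c1) * `|x n - y n| ^+ 2 by rewrite mulr_ge0 ?sqr_ge0// ltW.
  lra.
have F_cut_W n v : F v -> cut_W dot x0 (x n) v.
  (* [W_0] is the whole space because [x 0 = x0]. In the step, the segment from [x n.+1] to [v]
     stays in the set being projected onto. *)
  move=> Fv; elim: n => [|n IH]; first by rewrite x_0 /cut_W/= subrr linear0l.
  apply: metric_proj_cut_W (step3 n) => // t t01.
  by apply: cut_line => //; [case: (step3 n)|split; [exact: F_cut_H|]].
pose b n := `|x n - x0| ^+ 2.
have b_le n v : F v -> b n <= `|v - x0| ^+ 2.
  move=> Fv; have := cut_W_dist dot_norm (F_cut_W n v Fv).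
  by have := sqr_ge0 `|x n - v|; rewrite /b; lra.
have x_step n : `|x n.+1 - x n| ^+ 2 <= b n.+1 - b n.
  by rewrite distrC; apply: (cut_W_dist dot_norm); case: (step3 n) => -[].
have [u0 Fu0] := F_neq0.
have b_cvg : cvg (b @ \oo).
  apply: nondecreasing_is_cvgn.
    apply/nondecreasing_seqP => n.
    by have := x_step n; have := sqr_ge0 `|x n.+1 - x n|; lra.
  by exists (`|u0 - x0| ^+ 2) => _ [n _ <-]; exact: b_le.
set beta := lim (b @ \oo) in b_cvg.
have beta_le v : F v -> beta <= `|v - x0| ^+ 2.
  by move=> Fv; apply: cvgr_to_le b_cvg _; apply: nearW => n; exact: b_le.
have dx0 : `|x n.+1 - x n| @[n --> \oo] --> (0 : R).
  have db0 : b n.+1 - b n @[n --> \oo] --> (0 : R).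
    by rewrite -(subrr beta); apply: cvgB => //; rewrite cvg_shiftS.
  apply: (sqr_cvg0 db0) => n; exact: x_step.
have xz0 : `|x n - z n| @[n --> \oo] --> (0 : R).
  apply: (@squeeze_cvgr _ _ _ _ (fun=> 0) (fun n => eps^-1 * `|x n.+1 - x n|)).
  - apply: nearW => n; rewrite normr_ge0/= ler_pdivlMl//.
    have /andP[gam_ge _] := gam_bounds n.
    by apply: (cut_H_dist dot_norm gam_ge); case: (step3 n) => -[].
  - exact: cvg_cst.
  - by rewrite -[X in _ --> X](mulr0 eps^-1); apply: cvgM => //; exact: cvg_cst.
pose D := `|u0 - x0|.
have D0 : 0 <= D by exact: normr_ge0.
have x_x0_le n : `|x n - x0| <= D by rewrite -ler_sqr ?nnegrE//; exact: b_le.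
have x_u0_le n : `|x n - u0| <= 2 * D.
  rewrite -(subrKA x0); apply: le_trans (ler_normD _ _) _.
  by rewrite [`|x0 - u0|]distrC mulr2n mulrDl mul1r lerD2r.
have yx0 : `|y n - x n| @[n --> \oo] --> (0 : R).
  have g0 : (1 - 2 * mu * c1)^-1 * (`|x n - z n| * (4 * D)) @[n --> \oo] --> (0 : R).
    have gE : (1 - 2 * mu * c1)^-1 * (0 * (4 * D)) = 0 by rewrite mul0r mulr0.
    rewrite -[X in _ --> X]gE.
    by apply: cvgM; [exact: cvg_cst|apply: cvgM => //; exact: cvg_cst].
  apply: (sqr_cvg0 g0) => n; rewrite distrC ler_pdivlMl//.
  have := fejer n u0 Fu0; have := x_u0_le n.
  have : `|x n - u0| <= `|x n - z n| + `|z n - u0|.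
    by rewrite -[x n - u0](subrKA (z n)); exact: ler_normD.
  have := normr_ge0 (z n - u0); have := normr_ge0 (x n - u0).
  have := normr_ge0 (x n - z n).
  move: `|z n - u0| `|x n - u0| `|x n - z n| ((1 - 2 * mu * c1) * _) => a c d w.
  move=> d0 c0 a0 ca cD w_le.
  (* This is the difference of the squared distances of [x n] and [z n] to [u0]. If [a <= c], then
     [c + a <= 4 * D] and [c - a <= d]; otherwise the product is nonpositive. *)
  have : (c - a) * (c + a) <= d * (4 * D).
    have [ac|ca'] := leP a c.
      apply: (@le_trans _ _ (d * (c + a))).
        by rewrite ler_wpM2r; lra.
      by rewrite ler_wpM2l//; nra.
    by apply: (@le_trans _ _ 0); [rewrite mulr_le0_ge0; lra|rewrite mulr_ge0; lra].
  lra.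
have xM n : `|x n| <= D + `|x0|.
  by rewrite -[x n](subrK x0); apply: le_trans (ler_normD _ _) _; rewrite lerD2r.
have [p [s [s_ge xs_p]]] := bounded_weak_subsequence dot_norm xM.
have Fp : F p.
  move=> i _.
  (* The first index from [s k] on at which the [i]-th bifunction is active. *)
  pose m k := (s k + (i + (N - s k %% N)) %% N)%N.
  have m_i k : i_ (m k) = i.
    have skN : ((s k + (N - s k %% N)) %% N = 0)%N.
      by rewrite -modnDml subnKC ?modnn// ltnW// ltn_pmod.
    by apply/val_inj; rewrite /= modnDmr addnCA -modnDmr skN addn0 modn_small.
  have m_bounds k : (s k <= m k <= s k + N)%N.
    by rewrite leq_addr leq_add2l ltnW// ltn_pmod.
  have m_ge k : (k <= m k)%N by apply: leq_trans (s_ge k) _; case/andP: (m_bounds k).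
  apply: (EP_weak_limit dot_norm (K_closed i) (K_convex i) (A1 i) (A2 i) (A3 i) (A4 i)
    lam_gt0 (lam_ := lam_ \o m) (a := x \o m) (b := y \o m) _ _ (fun n => xM (m n))).
  - by move=> n; case/andP: (lam_bounds (m n)).
  - by move=> n; have := step1 (m n); rewrite m_i.
  - by apply: (weak_cvg_perturb dot_norm xs_p); exact: cvg_bounded_gap s_ge m_bounds.
  - exact: cvg_subseq m_ge yx0.
have beta_p : beta = `|p - x0| ^+ 2.
  apply/eqP; rewrite eq_le beta_le//=.
  (* Weak lower semicontinuity by hand: expand the square of [x (s k) - x0 - (p - x0)], which is
     nonnegative, and pass to the limit in the inner product. *)
  have lhs : 2 * dot ((x \o s) k - x0) (p - x0) @[k --> \oo] -->
      2 * dot (p - x0) (p - x0).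
    apply: cvgM; first exact: cvg_cst.
    under eq_fun do rewrite dotDl.
    by rewrite [dot (p - x0) (p - x0)]dotDl; apply: cvgD; [exact: xs_p|exact: cvg_cst].
  have rhs : b (s k) + `|p - x0| ^+ 2 @[k --> \oo] --> beta + `|p - x0| ^+ 2.
    by apply: cvgD; [exact: cvg_subseq|exact: cvg_cst].
  have : 2 * dot (p - x0) (p - x0) <= beta + `|p - x0| ^+ 2.
    apply: ler_cvg_to lhs rhs _; apply: nearW => k.
    have := sqr_ge0 `|x (s k) - x0 - (p - x0)|.
    by rewrite [X in 0 <= X](sqr_normB dot_norm) /b /=; lra.
  by rewrite dot_norm; lra.
have xp : x @ \oo --> p.
  apply/subr_cvg0; apply: norm_cvg0.
  apply: (@sqr_cvg0 _ _ (fun n => beta - b n)) => [|n].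
    by rewrite -(subrr beta); apply: cvgB => //; exact: cvg_cst.
  by rewrite beta_p; have := cut_W_dist dot_norm (F_cut_W n p Fp).
have perturb (v : nat -> H) : `|v n - x n| @[n --> \oo] --> (0 : R) -> v @ \oo --> p.
  by move=> /norm_cvg0 vx0; exact: cvg_sub0 vx0 xp.
exists p; split=> //.
(* [beta] is a lower bound for the squared distances from [x0] to points of [F], and [p] attains
   it. *)
- split=> // v Fv; rewrite distrC [`|x0 - v|]distrC -ler_sqr ?nnegrE//.
  by rewrite -beta_p; exact: beta_le.
- exact: perturb.
- by apply: perturb; under eq_fun do rewrite distrC.
Qed.
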